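(* $\mathsf{IVT}\equiv_{sW}\mathsf{C_I}$.
   Context: A represented space is a pair $(X,\delta_X)$ with $\delta_X:\subseteq\mathbb N^{\mathbb N}\to X$ a partial surjection. For a partial multi-valued map $f:\subseteq X\rightrightarrows Y$, a realizer of $f$ is a partial $F:\subseteq\mathbb N^{\mathbb N}\to\mathbb N^{\mathbb N}$ with $\delta_Y(F(p))\in f(\delta_X(p))$ for all $p\in\mathrm{dom}(f\circ\delta_X)$. $f\le_{sW}g$ (strong Weihrauch reducibility) means there are computable partial $H,K:\subseteq\mathbb N^{\mathbb N}\to\mathbb N^{\mathbb N}$ such that $H\circ G\circ K$ is a realizer of $f$ for every realizer $G$ of $g$; $\equiv_{sW}$ is the induced equivalence. $\mathcal A_-([0,1])$ is the set of closed subsets of $[0,1]$, where a name of $A$ is an enumeration of rational open intervals (open in $[0,1]$) whose union is $[0,1]\setminus A$. $\mathsf{C_I}:\subseteq\mathcal A_-([0,1])\rightrightarrows[0,1]$, $A\mapsto A$, defined on intervals $[a,b]$ with $0\le a\le b\le1$. $\mathcal C[0,1]$ is the space of continuous $f:[0,1]\to\mathbb R$ with its standard (function space / Cauchy) representation; reals use the Cauchy representation. $\mathsf{IVT}:\subseteq\mathcal C[0,1]\rightrightarrows[0,1]$, $f\mapsto\{x\in[0,1]:f(x)=0\}$, defined for $f$ with $f(0)\cdot f(1)<0$. *)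

(* Defs.v *)
From Stdlib Require Import Reals Lra QArith Qreals List Arith Cantor.
Open Scope R_scope.

Definition Baire := nat -> nat.

(** * Computability relative to an oracle: mu-recursive functions with an
    oracle primitive.  A code [c] computes (with oracle p : Baire) a partial
    function [list nat -> nat] given by the (deterministic) relation [eval]. *)
Inductive code : Type :=
| CZero
| CSucc
| CProj (i : nat)
| COracle
| CComp (f : code) (gs : list code)
| CPrec (f g : code)
| CMu (f : code).

Inductive eval (p : Baire) : code -> list nat -> nat -> Prop :=
| e_zero xs : eval p CZero xs 0
| e_succ xs : eval p CSucc xs (S (hd 0%nat xs))
| e_proj i xs : eval p (CProj i) xs (nth i xs 0%nat)
| e_oracle xs : eval p COracle xs (p (hd 0%nat xs))
| e_comp f gs xs ys v :
    evals p gs xs ys -> eval p f ys v -> eval p (CComp f gs) xs v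
| e_prec0 f g xs v : eval p f xs v -> eval p (CPrec f g) (0%nat :: xs) v
| e_precS f g n xs r v :
    eval p (CPrec f g) (n :: xs) r -> eval p g (n :: r :: xs) v ->
    eval p (CPrec f g) (S n :: xs) v
| e_mu f xs n :
    eval p f (n :: xs) 0%nat ->
    (forall m, (m < n)%nat -> exists k, eval p f (m :: xs) (S k)) ->
    eval p (CMu f) xs n
with evals (p : Baire) : list code -> list nat -> list nat -> Prop :=
| es_nil xs : evals p nil xs nil
| es_cons g gs xs y ys :
    eval p g xs y -> evals p gs xs ys -> evals p (g :: gs) xs (y :: ys).

(** The computable partial function [Baire -> Baire] computed by the oracle
    machine [c]: [comp_fun c p q] iff [c] on oracle [p] is defined on every
    input [n] and [q n] is its output.  (Its domain is the set of [p] for which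
    this holds; every computable partial function is a restriction of one of
    these.) *)
Definition comp_fun (c : code) (p q : Baire) : Prop :=
  forall n, eval p c (n :: nil) (q n).

Record rep_space := {
  carrier :> Type;
  (** [delta p x] : p is a name of x, i.e. delta_X(p) = x *)
  delta : Baire -> carrier -> Prop
}.

Record problem (X Y : rep_space) := {
  pdom : X -> Prop;
  pval : X -> Y -> Prop
}.
Arguments pdom {X Y} _ _.
Arguments pval {X Y} _ _ _.

(** A partial function F :⊆ Baire -> Baire is given by its domain [D] and
    values [F] (the values outside D being irrelevant). *)
Definition realizer {X Y : rep_space} (f : problem X Y)
    (D : Baire -> Prop) (F : Baire -> Baire) : Prop :=
  forall p x, delta X p x -> pdom f x ->
    D p /\ exists y, delta Y (F p) y /\ pval f x y.

Definition sW_le {X Y Z W : rep_space} (f : problem X Y) (g : problem Z W) : Prop :=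
  exists h k : code,
    forall (D : Baire -> Prop) (G : Baire -> Baire), realizer g D G ->
    forall p x, delta X p x -> pdom f x ->
      exists q, comp_fun k p q /\ D q /\
        exists r, comp_fun h (G q) r /\
          exists y, delta Y r y /\ pval f x y.

Definition sW_equiv {X Y Z W : rep_space} (f : problem X Y) (g : problem Z W) : Prop :=
  sW_le f g /\ sW_le g f.

Definition z_of_nat (a : nat) : Z :=
  if Nat.even a then Z.of_nat (a / 2) else (- Z.of_nat (S a / 2))%Z.

Definition q_of_nat (n : nat) : Q :=
  let (a, b) := Cantor.of_nat n in Qmake (z_of_nat a) (Pos.of_succ_nat b).

Definition qr (n : nat) : R := Q2R (q_of_nat n).

Definition real_name (p : Baire) (x : R) : Prop :=
  forall n, Rabs (qr (p n) - x) <= / 2 ^ n.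

Definition unit_interval : rep_space :=
  {| carrier := R;
     delta := fun p x => 0 <= x <= 1 /\ real_name p x |}.

(** C[0,1]: Cauchy representation w.r.t. rational polynomials and the sup
    norm on [0,1].  Name p: for each n, p <n,0> is a degree d and
    p <n,i+1> (i <= d) codes the i-th rational coefficient of the n-th
    approximating polynomial P_n, with sup_{[0,1]} |f - P_n| <= 2^-n.
    Elements are represented by functions R -> R, only their restriction
    to [0,1] being relevant. *)
Definition approx_poly (p : Baire) (n : nat) (x : R) : R :=
  sum_f_R0 (fun i => qr (p (Cantor.to_nat (n, S i))) * x ^ i)
           (p (Cantor.to_nat (n, 0%nat))).

Definition cfun_name (p : Baire) (f : R -> R) : Prop :=
  forall n x, 0 <= x <= 1 -> Rabs (f x - approx_poly p n x) <= / 2 ^ n.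

Definition C01 : rep_space :=
  {| carrier := R -> R; delta := cfun_name |}.

(** A_-([0,1]): negative information. Code m denotes the rational open
    interval (a,b) ∩ [0,1] (open in [0,1]; empty if b <= a), where
    (a,b) = (q_of_nat i, q_of_nat j) and <i,j> = m. *)
Definition in_rat_interval (m : nat) (x : R) : Prop :=
  let (i, j) := Cantor.of_nat m in
  qr i < x < qr j /\ 0 <= x <= 1.

Definition closed_name (p : Baire) (A : R -> Prop) : Prop :=
  (forall x, A x -> 0 <= x <= 1) /\
  (forall x, (0 <= x <= 1 /\ ~ A x) <-> exists n, in_rat_interval (p n) x).

Definition closed01 : rep_space :=
  {| carrier := R -> Prop; delta := closed_name |}.

Definition C_I : problem closed01 unit_interval :=
  @Build_problem closed01 unit_interval
   (fun (A : R -> Prop) => exists a b, 0 <= a /\ a <= b /\ b <= 1 /\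
                                   (forall x, A x <-> a <= x <= b))
     ( fun (A : R -> Prop) (x : R) => A x).

Definition IVT : problem C01 unit_interval :=
  @Build_problem C01 unit_interval ( fun (f : R -> R) => f 0 * f 1 < 0)
     ( fun (f : R -> R) (x : R) => 0 <= x <= 1 /\ f x = 0).

(* Main.v *)
From Stdlib Require Import Reals Lra Lia ZArith Qreals List Cantor.
Require Import Defs.

(** [IVT <= C_I]: start from [[0,1]] and run through all pairs of a rational [c] and a
    precision [k].  Whenever [c] lies in the current interval and the [k]-th approximating
    polynomial certifies that [f c] and [f 0] (or [f 1]) have opposite signs, [c] becomes
    the new right (or left) endpoint.  In the limit interval [[a,b]] the function vanishes
    at every rational strictly between [a] and [b], and the sign conditions at the endpoints
    settle the case [a = b]; so any point of [[a,b]] is a zero and no postprocessing is needed.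

    [C_I <= IVT]: from a name of [[a,b]] compute rationals [c_s] increasing to [a] and [d_s]
    decreasing to [b], by absorbing listed intervals that contain the current endpoint.
    The function [sum_s 2^-(s+1) (max(0, t - d_s) - max(0, c_s - t))] is negative for [t < a],
    zero on [[a,b]] and positive for [t > b].  The substitution [t = 3x - 1] makes
    the values at [x = 0] and [x = 1] nonzero even when [a = 0] or [b = 1].
    Polynomial approximations are the Bernstein polynomials of the (Lipschitz) partial sums,
    whose [j]-th coefficient is [binom N j] times the [j]-th forward difference of the samples. *)

(** * Closure properties of oracle-computable functions *)

Local Open Scope nat_scope.

(* Only contexts of length exactly [k] matter, because the parameters of a primitive
   recursion have to be rebuilt from a fixed list of projections. *)
Definition computable (k : nat) (F : Baire -> list nat -> nat) : Prop :=
  exists c, forall p xs, length xs = k -> eval p c xs (F p xs).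

Lemma computable_ext k F G :
  (forall p xs, length xs = k -> F p xs = G p xs) -> computable k F -> computable k G.
Proof. intros E [c H]. exists c. intros p xs L. rewrite <- E by easy. auto. Qed.

Lemma computable_comp m k F Gs :
  length Gs = m -> computable m F -> Forall (computable k) Gs ->
  computable k (fun p xs => F p (map (fun G => G p xs) Gs)).
Proof.
intros L [c Hc] HG.
assert (exists gs, forall p xs, length xs = k ->
          evals p gs xs (map (fun G => G p xs) Gs)) as [gs Hgs].
{ clear L. induction HG as [|G Gs [g Hg] _ [gs IH]].
  - exists nil. intros. constructor.
  - exists (g :: gs). intros. constructor; auto. }
exists (CComp c gs). intros p xs Lx. econstructor.
- now apply Hgs.
- apply Hc. now rewrite length_map.
Qed.

Lemma nth_hd i (xs : list nat) : nth i xs 0 = hd 0 (Nat.iter i (@tl nat) xs).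
Proof.
revert xs; induction i as [|i IH]; intros xs; [now destruct xs|].
rewrite Nat.iter_succ_r, <- IH. destruct xs; [now destruct i | reflexivity].
Qed.

(** Variables are written with [hd] and [tl], the form in which the binding lemmas below present an
    extended context. *)
Lemma computable_var i k : computable k (fun _ xs => hd 0 (Nat.iter i (@tl nat) xs)).
Proof. exists (CProj i). intros. rewrite <- nth_hd. constructor. Qed.

Lemma map_nth_seq (xs : list nat) : map (fun i => nth i xs 0) (seq 0 (length xs)) = xs.
Proof.
induction xs as [|x xs IH]; [reflexivity|]. simpl. f_equal.
rewrite <- seq_shift, map_map. exact IH.
Qed.

Definition projections (i k : nat) : list (Baire -> list nat -> nat) :=
  map (fun j _ xs => nth j xs 0) (seq i k).

Lemma computable_projections i k m : Forall (computable m) (projections i k).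
Proof.
apply Forall_map, Forall_forall. intros j _.
apply computable_ext with (2 := computable_var j m). intros. now rewrite nth_hd.
Qed.

Lemma projections_eq k p xs :
  length xs = k -> map (fun G => G p xs) (projections 0 k) = xs.
Proof.
intros <-. unfold projections. rewrite map_map. apply map_nth_seq.
Qed.

Lemma projections_tl k p xs :
  length xs = S k -> map (fun G => G p xs) (projections 1 k) = tl xs.
Proof.
destruct xs as [|x xs]; intros L; [easy|]. injection L as <-.
unfold projections. rewrite map_map, <- seq_shift, map_map. apply map_nth_seq.
Qed.

Lemma computable_tl k F : computable k F -> computable (S k) (fun p ys => F p (tl ys)).
Proof.
intros HF.
apply computable_ext
  with (fun p ys => F p (map (fun G => G p ys) (projections 1 k))).
- intros p xs L. now rewrite projections_tl.
- apply (computable_comp k (S k) F); auto using computable_projections.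
  unfold projections. now rewrite length_map, length_seq.
Qed.

(** Substitution: the body is composed with [A] followed by all projections of the context. It
    reduces an operation on a computed argument to the same operation on a variable. *)
Lemma computable_let k (body : Baire -> nat -> list nat -> nat) A :
  computable (S k) (fun p ys => body p (hd 0 ys) (tl ys)) -> computable k A ->
  computable k (fun p xs => body p (A p xs) xs).
Proof.
intros HF HA.
apply computable_ext with
  (fun p xs => (fun p ys => body p (hd 0 ys) (tl ys)) p
     (map (fun G => G p xs) (A :: projections 0 k))).
- intros p xs L. cbn [map hd tl]. now rewrite projections_eq.
- apply (computable_comp (S k) k (fun p ys => body p (hd 0 ys) (tl ys)));
    auto using computable_projections.
  unfold projections. simpl. now rewrite length_map, length_seq.
Qed.

(** Weakening below the first variable; it is needed when a summand in one index is evaluated inside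
    a recursion that adds its own variables. *)
Lemma computable_skip k (body : Baire -> nat -> list nat -> nat) :
  computable (S k) (fun p ys => body p (hd 0 ys) (tl ys)) ->
  computable (S (S k)) (fun p ys => body p (hd 0 ys) (tl (tl ys))).
Proof.
intros HF.
apply computable_ext with
  (fun p xs => (fun p ys => body p (hd 0 ys) (tl ys)) p
     (map (fun G => G p xs) ((fun _ ys => hd 0 ys) :: projections 2 k))).
- intros p [|x [|y xs]] L; [easy..|]. injection L as <-. cbn [map hd tl]. f_equal.
  unfold projections. rewrite map_map, <- !seq_shift, !map_map. apply map_nth_seq.
- apply (computable_comp (S k) _ (fun p ys => body p (hd 0 ys) (tl ys))).
  + unfold projections. simpl. now rewrite length_map, length_seq.
  + exact HF.
  + constructor; [exact (computable_var 0 _) | apply computable_projections].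
Qed.

(** [computable_let] first turns the bound [A] into a variable, since [CPrec] recurses on the head
    of its argument list; the evaluation is then derived by induction on that head. *)
Lemma computable_rec k (body : Baire -> nat -> nat -> list nat -> nat) A B :
  computable k A -> computable k B ->
  computable (S (S k)) (fun p ys => body p (hd 0 ys) (hd 0 (tl ys)) (tl (tl ys))) ->
  computable k (fun p xs =>
    nat_rect (fun _ => nat) (B p xs) (fun n r => body p n r xs) (A p xs)).
Proof.
intros HA [b Hb] [c Hc].
apply (computable_let k (fun p n xs =>
  nat_rect (fun _ => nat) (B p xs) (fun n r => body p n r xs) n)); [|exact HA].
exists (CPrec b c). intros p [|n xs] L; [easy|]. injection L as L. cbn [hd tl].
induction n as [|n IH].
- constructor. now apply Hb.
- econstructor; [exact IH|]. apply (Hc p (n :: _ :: xs)). simpl. now rewrite L.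
Qed.

Lemma computable_oracle k A : computable k A -> computable k (fun p xs => p (A p xs)).
Proof.
apply (computable_let k (fun p n _ => p n)). exists COracle. intros. constructor.
Qed.

Lemma computable_S k A : computable k A -> computable k (fun p xs => S (A p xs)).
Proof.
apply (computable_let k (fun p n _ => S n)). exists CSucc. intros. constructor.
Qed.

Lemma computable_const k n : computable k (fun _ _ => n).
Proof.
induction n as [|n IH]; [exists CZero; constructor | now apply computable_S].
Qed.

Create HintDb computable.
Hint Constants Opaque : computable.
Hint Resolve computable_oracle computable_S computable_const : computable.

(** The [tl] cases strip the variables added by a recursion, so that hypotheses about the original
    context apply again. *)
Ltac computable_step :=
  lazymatch goal with
  | |- computable _ (fun p xs => hd 0 xs) => exact (computable_var 0 _)
  | |- computable _ (fun p xs => hd 0 (tl xs)) => exact (computable_var 1 _)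
  | |- computable _ (fun p xs => nat_rect (fun _ => nat) _ _ _) =>
      apply computable_rec; cbv beta
  | |- computable _ (fun p xs => ?F p (tl xs)) => apply (computable_tl _ F)
  | |- computable _ (fun p xs => ?F p (tl (tl xs))) =>
      apply (computable_tl _ (fun p ys => F p (tl ys)))
  end.
Hint Extern 3 => computable_step : computable.

Ltac computability := cbv beta; solve [auto 60 with computable nocore].

Lemma computable_pred k A : computable k A -> computable k (fun p xs => pred (A p xs)).
Proof.
intros HA.
apply computable_ext with
  (fun p xs => nat_rect (fun _ => nat) 0 (fun n _ => n) (A p xs)).
- intros p xs _. now destruct (A p xs).
- computability.
Qed.
Hint Resolve computable_pred : computable.

Lemma computable_add k A B :
  computable k A -> computable k B -> computable k (fun p xs => A p xs + B p xs).
Proof.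
intros HA HB.
apply computable_ext with
  (fun p xs => nat_rect (fun _ => nat) (B p xs) (fun _ r => S r) (A p xs)).
- intros p xs _. induction (A p xs); simpl; congruence.
- computability.
Qed.
Hint Resolve computable_add : computable.

Lemma computable_mul k A B :
  computable k A -> computable k B -> computable k (fun p xs => A p xs * B p xs).
Proof.
intros HA HB.
apply computable_ext with
  (fun p xs => nat_rect (fun _ => nat) 0 (fun _ r => B p xs + r) (A p xs)).
- intros p xs _. induction (A p xs); simpl; congruence.
- computability.
Qed.
Hint Resolve computable_mul : computable.

Lemma computable_sub k A B :
  computable k A -> computable k B -> computable k (fun p xs => A p xs - B p xs).
Proof.
intros HA HB.
apply computable_ext with
  (fun p xs => nat_rect (fun _ => nat) (A p xs) (fun _ r => pred r) (B p xs)).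
- intros p xs _. induction (B p xs) as [|n IH]; simpl; [lia|rewrite IH; lia].
- computability.
Qed.
Hint Resolve computable_sub : computable.

Lemma computable_pow k n A :
  computable k A -> computable k (fun p xs => n ^ A p xs).
Proof.
intros HA.
apply computable_ext with
  (fun p xs => nat_rect (fun _ => nat) 1 (fun _ r => n * r) (A p xs)).
- intros p xs _. induction (A p xs); simpl; congruence.
- computability.
Qed.
Hint Resolve computable_pow : computable.

Definition decidable_in (k : nat) (T : Baire -> list nat -> bool) : Prop :=
  computable k (fun p xs => Nat.b2n (T p xs)).

Lemma computable_if k T A B :
  decidable_in k T -> computable k A -> computable k B ->
  computable k (fun p xs => if T p xs then A p xs else B p xs).
Proof.
unfold decidable_in. intros HT HA HB.
apply computable_ext with
  (fun p xs => Nat.b2n (T p xs) * A p xs + (1 - Nat.b2n (T p xs)) * B p xs).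
- intros p xs _. destruct (T p xs); simpl; lia.
- computability.
Qed.

Lemma decidable_leb k A B :
  computable k A -> computable k B -> decidable_in k (fun p xs => A p xs <=? B p xs).
Proof.
intros HA HB. apply computable_ext with (fun p xs => 1 - (A p xs - B p xs)).
- intros p xs _. destruct (Nat.leb_spec (A p xs) (B p xs)); unfold Nat.b2n; lia.
- computability.
Qed.

Lemma decidable_ltb k A B :
  computable k A -> computable k B -> decidable_in k (fun p xs => A p xs <? B p xs).
Proof. intros HA HB. apply (decidable_leb k (fun p xs => S (A p xs))); computability. Qed.

Lemma decidable_andb k S T :
  decidable_in k S -> decidable_in k T -> decidable_in k (fun p xs => (S p xs && T p xs)%bool).
Proof.
unfold decidable_in. intros HS HT.
apply computable_ext with (fun p xs => Nat.b2n (S p xs) * Nat.b2n (T p xs)).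
- intros p xs _. now destruct (S p xs), (T p xs).
- computability.
Qed.

Lemma decidable_orb k S T :
  decidable_in k S -> decidable_in k T -> decidable_in k (fun p xs => (S p xs || T p xs)%bool).
Proof.
unfold decidable_in. intros HS HT.
apply computable_ext with
  (fun p xs => 1 - (1 - Nat.b2n (S p xs)) * (1 - Nat.b2n (T p xs))).
- intros p xs _. now destruct (S p xs), (T p xs).
- computability.
Qed.

Lemma decidable_even k A :
  computable k A -> decidable_in k (fun p xs => Nat.even (A p xs)).
Proof.
intros HA.
apply computable_ext with
  (fun p xs => nat_rect (fun _ => nat) 1 (fun _ r => 1 - r) (A p xs)).
- intros p xs _. induction (A p xs) as [|n IH]; [reflexivity|].
  rewrite Nat.even_succ, <- Nat.negb_even. cbn [nat_rect]. rewrite IH.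
  now destruct (Nat.even n).
- computability.
Qed.
Hint Resolve computable_if decidable_leb decidable_ltb decidable_andb decidable_orb
  decidable_even : computable.

(** Passing from n to n+1 raises the half exactly when n is odd, which gives a primitive
    recursion. *)
Lemma computable_div2 k A : computable k A -> computable k (fun p xs => Nat.div2 (A p xs)).
Proof.
intros HA.
apply computable_ext with
  (fun p xs => nat_rect (fun _ => nat) 0 (fun n r => if Nat.even n then r else S r) (A p xs)).
- intros p xs _. induction (A p xs) as [|n IH]; [reflexivity|]. cbn [nat_rect].
  rewrite IH. destruct (Nat.even n) eqn:E.
  + apply Nat.even_spec in E. now rewrite Nat.Even_div2.
  + rewrite <- Nat.negb_odd in E. apply Bool.negb_false_iff, Nat.odd_spec in E.
    now rewrite Nat.Odd_div2.
- computability.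
Qed.
Hint Resolve computable_div2 : computable.

(** * Computability of Cantor pairing and its projections *)

Definition pairn (x y : nat) : nat := Cantor.to_nat (x, y).
Definition fstn (n : nat) : nat := fst (Cantor.of_nat n).
Definition sndn (n : nat) : nat := snd (Cantor.of_nat n).

Lemma fstn_pairn x y : fstn (pairn x y) = x.
Proof. unfold fstn, pairn. now rewrite Cantor.cancel_of_to. Qed.

Lemma sndn_pairn x y : sndn (pairn x y) = y.
Proof. unfold sndn, pairn. now rewrite Cantor.cancel_of_to. Qed.

Lemma of_nat_fstn_sndn n : Cantor.of_nat n = (fstn n, sndn n).
Proof. apply surjective_pairing. Qed.

(** The triangular number n(n+1)/2, in a form convertible with the sum inside [Cantor.to_nat]. *)
Definition triangle (n : nat) : nat := nat_rect (fun _ => nat) 0 (fun i m => S i + m) n.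

Lemma computable_triangle k A :
  computable k A -> computable k (fun p xs => triangle (A p xs)).
Proof. intros HA. unfold triangle. computability. Qed.
Hint Resolve computable_triangle : computable.

Lemma computable_pairn k A B :
  computable k A -> computable k B -> computable k (fun p xs => pairn (A p xs) (B p xs)).
Proof.
intros HA HB.
apply computable_ext with (fun p xs => B p xs + triangle (B p xs + A p xs)).
- reflexivity.
- computability.
Qed.
Hint Resolve computable_pairn : computable.

(** The largest s with [triangle s <= n], which is the sum of the two coordinates coded by n. It
    grows by at most one per step, so one comparison per step suffices. *)
Definition diagonal (n : nat) : nat :=
  nat_rect (fun _ => nat) 0 (fun m s => if triangle (S s) <=? S m then S s else s) n.

Lemma diagonal_spec n : triangle (diagonal n) <= n < triangle (S (diagonal n)).
Proof.
induction n as [|n IH]; [simpl; lia|].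
change (diagonal (S n)) with
  (if triangle (S (diagonal n)) <=? S n then S (diagonal n) else diagonal n).
destruct (Nat.leb_spec (triangle (S (diagonal n))) (S n)) as [H|H]; [|lia].
change (triangle (S (S (diagonal n)))) with
  (S (S (diagonal n)) + triangle (S (diagonal n))). lia.
Qed.

Lemma triangle_mono m n : m <= n -> triangle m <= triangle n.
Proof. induction 1; simpl in *; lia. Qed.

Lemma diagonal_pairn x y : diagonal (pairn x y) = y + x.
Proof.
pose proof (diagonal_spec (pairn x y)) as H.
change (pairn x y) with (y + triangle (y + x)) in *.
destruct (Nat.lt_trichotomy (diagonal (y + triangle (y + x))) (y + x)) as [L|[L|L]]; auto.
- pose proof (triangle_mono _ _ L). lia.
- pose proof (triangle_mono _ _ L). simpl in *. lia.
Qed.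

(** The code of (x, y) is y plus the triangular number of x + y, so subtracting the latter recovers
    y. This replaces [Cantor.of_nat] by operations already known to be computable. *)
Lemma sndn_eq n : sndn n = n - triangle (diagonal n).
Proof.
pose proof (Cantor.cancel_to_of n) as E. rewrite of_nat_fstn_sndn in E.
rewrite <- E at 2 3. fold (pairn (fstn n) (sndn n)). rewrite diagonal_pairn.
change (pairn (fstn n) (sndn n)) with (sndn n + triangle (sndn n + fstn n)). lia.
Qed.

Lemma fstn_eq n : fstn n = diagonal n - sndn n.
Proof.
pose proof (Cantor.cancel_to_of n) as E. rewrite of_nat_fstn_sndn in E.
rewrite <- E at 2. fold (pairn (fstn n) (sndn n)). rewrite diagonal_pairn. lia.
Qed.

Lemma computable_diagonal k A :
  computable k A -> computable k (fun p xs => diagonal (A p xs)).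
Proof. intros HA. unfold diagonal. computability. Qed.
Hint Resolve computable_diagonal : computable.

Lemma computable_sndn k A : computable k A -> computable k (fun p xs => sndn (A p xs)).
Proof.
intros HA.
apply computable_ext with (fun p xs => A p xs - triangle (diagonal (A p xs))).
- intros. now rewrite sndn_eq.
- computability.
Qed.
Hint Resolve computable_sndn : computable.

Lemma computable_fstn k A : computable k A -> computable k (fun p xs => fstn (A p xs)).
Proof.
intros HA.
apply computable_ext with (fun p xs => diagonal (A p xs) - sndn (A p xs)).
- intros. now rewrite fstn_eq.
- computability.
Qed.
Hint Resolve computable_fstn : computable.

(** * Arithmetic on codes of rationals *)

Definition qpos (a : nat) : nat := if Nat.even (fstn a) then Nat.div2 (fstn a) else 0.
Definition qneg (a : nat) : nat := if Nat.even (fstn a) then 0 else Nat.div2 (S (fstn a)).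
Definition qden (a : nat) : nat := S (sndn a).

(** The code of (P - M)/D. In the numerator 2n codes n and 2n-1 codes -n; the denominator is stored
    minus one. Keeping positive and negative parts apart leaves all arithmetic in the natural
    numbers. *)
Definition qmk (P M D : nat) : nat :=
  pairn (if M <=? P then 2 * (P - M) else pred (2 * (M - P))) (pred D).

Definition qadd (a b : nat) : nat :=
  qmk (qpos a * qden b + qpos b * qden a) (qneg a * qden b + qneg b * qden a)
      (qden a * qden b).
Definition qopp (a : nat) : nat := qmk (qneg a) (qpos a) (qden a).
Definition qmul (a b : nat) : nat :=
  qmk (qpos a * qpos b + qneg a * qneg b) (qpos a * qneg b + qneg a * qpos b)
      (qden a * qden b).
(** Cross-multiplied comparison, with each negative part moved to the other side. *)
Definition qltb (a b : nat) : bool :=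
  qpos a * qden b + qneg b * qden a <? qpos b * qden a + qneg a * qden b.
Definition qsub (a b : nat) : nat := qadd a (qopp b).
Definition qmax0 (a : nat) : nat := if qltb 0 a then a else 0.
Definition qfrac (m n : nat) : nat := qmk m 0 n.
Definition qsum (f : nat -> nat) (n : nat) : nat :=
  nat_rect (fun _ => nat) (f 0) (fun m r => qadd r (f (S m))) n.
Definition qpow (a n : nat) : nat :=
  nat_rect (fun _ => nat) (qfrac 1 1) (fun _ r => qmul a r) n.

Section RationalComputability.
Context (k : nat) (A B C : Baire -> list nat -> nat)
  (HA : computable k A) (HB : computable k B) (HC : computable k C).

Lemma computable_qpos : computable k (fun p xs => qpos (A p xs)).
Proof. unfold qpos. computability. Qed.

Lemma computable_qneg : computable k (fun p xs => qneg (A p xs)).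
Proof. unfold qneg. computability. Qed.

Lemma computable_qden : computable k (fun p xs => qden (A p xs)).
Proof. unfold qden. computability. Qed.

Lemma computable_qmk : computable k (fun p xs => qmk (A p xs) (B p xs) (C p xs)).
Proof. unfold qmk. computability. Qed.
End RationalComputability.
Hint Resolve computable_qpos computable_qneg computable_qden computable_qmk : computable.

Section RationalComputability.
Context (k : nat) (A B : Baire -> list nat -> nat)
  (HA : computable k A) (HB : computable k B).

Lemma computable_qadd : computable k (fun p xs => qadd (A p xs) (B p xs)).
Proof. unfold qadd. computability. Qed.

Lemma computable_qopp : computable k (fun p xs => qopp (A p xs)).
Proof. unfold qopp. computability. Qed.

Lemma computable_qmul : computable k (fun p xs => qmul (A p xs) (B p xs)).
Proof. unfold qmul. computability. Qed.

Lemma decidable_qltb : decidable_in k (fun p xs => qltb (A p xs) (B p xs)).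
Proof. unfold qltb. computability. Qed.

Lemma computable_qfrac : computable k (fun p xs => qfrac (A p xs) (B p xs)).
Proof. unfold qfrac. computability. Qed.
End RationalComputability.
Hint Resolve computable_qadd computable_qopp computable_qmul decidable_qltb
  computable_qfrac : computable.

Section RationalComputability.
Context (k : nat) (A B : Baire -> list nat -> nat)
  (HA : computable k A) (HB : computable k B).

Lemma computable_qsub : computable k (fun p xs => qsub (A p xs) (B p xs)).
Proof. unfold qsub. computability. Qed.

Lemma computable_qmax0 : computable k (fun p xs => qmax0 (A p xs)).
Proof. unfold qmax0. computability. Qed.

Lemma computable_qpow : computable k (fun p xs => qpow (A p xs) (B p xs)).
Proof. unfold qpow. computability. Qed.

Lemma computable_qsum (F : Baire -> nat -> list nat -> nat) :
  computable (S k) (fun p ys => F p (hd 0 ys) (tl ys)) ->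
  computable k (fun p xs => qsum (fun i => F p i xs) (A p xs)).
Proof.
intros HF. unfold qsum. apply computable_rec; [exact HA| |].
- apply (computable_let k F (fun _ _ => 0)); [exact HF|computability].
(* The recursion step evaluates the summand at the successor of the counter, below the counter and
   the accumulator; hence one substitution and two weakenings. *)
- assert (computable (S (S k)) (fun p ys => F p (S (hd 0 ys)) (tl (tl ys)))).
  { apply (computable_let (S (S k)) (fun p i ys => F p i (tl (tl ys))) 
             (fun p ys => S (hd 0 ys))); [|computability].
    apply (computable_skip _ (fun p i ys => F p i (tl ys))), computable_skip, HF. }
  computability.
Qed.
End RationalComputability.
Hint Resolve computable_qsub computable_qmax0 computable_qpow computable_qsum : computable.

(** * Real values of rational codes *)

Local Open Scope R_scope.

Lemma qr_eq a : qr a = (INR (qpos a) - INR (qneg a)) / INR (qden a).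
Proof.
unfold qr, q_of_nat, qpos, qneg, qden. rewrite of_nat_fstn_sndn. unfold Q2R. cbn [Qnum Qden].
assert (E : IZR (Z.pos (Pos.of_succ_nat (sndn a))) = INR (S (sndn a))).
{ now rewrite INR_IZR_INZ, Nat2Z.inj_succ, Zpos_P_of_succ_nat. }
rewrite E. unfold Rdiv. f_equal.
unfold z_of_nat. rewrite <- !Nat.div2_div. destruct (Nat.even (fstn a)).
- rewrite <- INR_IZR_INZ. simpl (INR 0). ring.
- rewrite opp_IZR, <- INR_IZR_INZ. simpl (INR 0). ring.
Qed.

Lemma INR_qden_pos a : 0 < INR (qden a).
Proof. apply lt_0_INR. unfold qden. lia. Qed.

Lemma qr_qmk P M D : (0 < D)%nat -> qr (qmk P M D) = (INR P - INR M) / INR D.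
Proof.
intros HD. rewrite qr_eq. unfold qmk, qden, qpos, qneg.
rewrite fstn_pairn, sndn_pairn, Nat.succ_pred by lia. unfold Rdiv. f_equal.
destruct (Nat.leb_spec M P) as [H|H].
- rewrite Nat.even_even, Nat.div2_double.
  rewrite minus_INR by easy. simpl (INR 0). ring.
- replace (pred (2 * (M - P))) with (S (2 * (M - P - 1)))%nat by lia.
  rewrite Nat.even_succ, Nat.odd_even.
  replace (S (S (2 * (M - P - 1))))%nat with (2 * (M - P))%nat by lia.
  rewrite Nat.div2_double, minus_INR by lia. simpl (INR 0). ring.
Qed.

Lemma qr_qadd a b : qr (qadd a b) = qr a + qr b.
Proof.
pose proof (INR_qden_pos a). pose proof (INR_qden_pos b).
unfold qadd. rewrite qr_qmk by (unfold qden; lia). rewrite !qr_eq, !plus_INR, !mult_INR.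
field. lra.
Qed.

Lemma qr_qopp a : qr (qopp a) = - qr a.
Proof.
pose proof (INR_qden_pos a).
unfold qopp. rewrite qr_qmk by (unfold qden; lia). rewrite !qr_eq. field. lra.
Qed.

Lemma qr_qmul a b : qr (qmul a b) = qr a * qr b.
Proof.
pose proof (INR_qden_pos a). pose proof (INR_qden_pos b).
unfold qmul. rewrite qr_qmk by (unfold qden; lia). rewrite !qr_eq, !plus_INR, !mult_INR.
field. lra.
Qed.

Lemma qr_qsub a b : qr (qsub a b) = qr a - qr b.
Proof. unfold qsub. rewrite qr_qadd, qr_qopp. ring. Qed.

Lemma qr_qfrac m n : (0 < n)%nat -> qr (qfrac m n) = INR m / INR n.
Proof. intros H. unfold qfrac. rewrite qr_qmk by easy. simpl (INR 0). now rewrite Rminus_0_r. Qed.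

Lemma qr_0 : qr 0 = 0.
Proof.
rewrite qr_eq. change (qpos 0) with 0%nat. change (qneg 0) with 0%nat. simpl INR.
unfold Rdiv. ring.
Qed.

Lemma qltb_spec a b : Bool.reflect (qr a < qr b) (qltb a b).
Proof.
pose proof (INR_qden_pos a) as Ha. pose proof (INR_qden_pos b) as Hb.
assert (E : qr b - qr a =
  (INR (qpos b * qden a + qneg a * qden b) - INR (qpos a * qden b + qneg b * qden a))
   / (INR (qden a) * INR (qden b))).
{ rewrite !qr_eq, !plus_INR, !mult_INR. field. lra. }
assert (Hab : 0 < / (INR (qden a) * INR (qden b))) by (apply Rinv_0_lt_compat; nra).
unfold Rdiv in E. unfold qltb. apply iff_reflect. rewrite Nat.ltb_lt. split; intros H.
- apply INR_lt. nra.
- apply lt_INR in H. nra.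
Qed.

Lemma qr_qmax0 a : qr (qmax0 a) = Rmax 0 (qr a).
Proof.
unfold qmax0. destruct (qltb_spec 0 a) as [H|H]; rewrite qr_0 in H.
- rewrite Rmax_right; lra.
- rewrite Rmax_left, qr_0; lra.
Qed.

Lemma qr_qsum f n : qr (qsum f n) = sum_f_R0 (fun i => qr (f i)) n.
Proof. induction n as [|n IH]; [reflexivity|].
change (qsum f (S n)) with (qadd (qsum f n) (f (S n))). now rewrite qr_qadd, IH. Qed.

Lemma qr_qpow a n : qr (qpow a n) = qr a ^ n.
Proof.
induction n as [|n IH].
- change (qpow a 0) with (qfrac 1 1). rewrite qr_qfrac by lia. simpl. field.
- change (qpow a (S n)) with (qmul a (qpow a n)). now rewrite qr_qmul, IH.
Qed.

(** Take D with 1/D < y - x and divide the least integer above xD by D. As x is nonnegative, the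
    numerator is a natural number, as [qfrac] expects. *)
Lemma qr_dense x y : 0 <= x < y -> exists c, x < qr c < y.
Proof.
intros H.
destruct (archimed_cor1 (y - x)) as [D [HD1 HD2]]; [lra|].
apply lt_0_INR in HD2 as HD.
assert (Hn : 1 < (y - x) * INR D).
{ apply Rmult_lt_compat_r with (r := INR D) in HD1; [|easy]. rewrite Rinv_l in HD1; lra. }
destruct (archimed (x * INR D)) as [U1 U2].
assert (0 <= up (x * INR D))%Z as U0.
{ apply le_IZR. nra. }
rewrite <- (Z2Nat.id _ U0), <- INR_IZR_INZ in U1, U2.
set (m := Z.to_nat (up (x * INR D))) in *. exists (qfrac m D).
rewrite qr_qfrac by lia.
replace x with (x * INR D / INR D) at 1 by (field; lra).
replace y with (y * INR D / INR D) by (field; lra).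
split; apply Rmult_lt_compat_r; try (apply Rinv_0_lt_compat; lra); lra.
Qed.

(** Both translations are total computable maps here, so no domains have to be tracked. [H] receives
    only the name [r] of the solution and not [p], which is what makes the reduction strong. *)
Lemma sW_le_intro (X Y Z W : rep_space) (f : problem X Y) (g : problem Z W)
    (H K : Baire -> nat -> nat) :
  computable 1 (fun p xs => H p (hd 0%nat xs)) ->
  computable 1 (fun p xs => K p (hd 0%nat xs)) ->
  (forall p x, delta X p x -> pdom f x ->
    exists z, delta Z (K p) z /\ pdom g z /\
      forall r w, delta W r w -> pval g z w ->
        exists y, delta Y (H r) y /\ pval f x y) ->
  sW_le f g.
Proof.
intros [h Hh] [k Hk] HK. exists h, k. intros D G HG p x Hp Hx.
destruct (HK p x Hp Hx) as (z & Hz & Hgz & HH).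
destruct (HG (K p) z Hz Hgz) as (HD & w & Hw & Hzw).
exists (K p). split; [|split; [exact HD|]].
- intros n. now apply (Hk p (n :: nil)).
- exists (H (G (K p))). split; [|exact (HH _ _ Hw Hzw)].
  intros n. now apply (Hh (G (K p)) (n :: nil)).
Qed.

(** * Suprema of sequences and continuity of named functions *)

Lemma inv_pow2_pos n : 0 < / 2 ^ n.
Proof. apply Rinv_0_lt_compat, pow_lt. lra. Qed.

Lemma inv_pow2_S n : / 2 ^ S n = / 2 ^ n / 2.
Proof. simpl. rewrite Rinv_mult. field. apply pow_nonzero. lra. Qed.

Lemma inv_pow2_small e : 0 < e -> exists n, / 2 ^ n < e.
Proof.
intros He. destruct (pow_lt_1_zero (/ 2)) with (y := e) as [n Hn].
- rewrite Rabs_right; lra.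
- exact He.
- exists n. specialize (Hn n (Nat.le_refl n)). rewrite pow_inv in Hn.
  apply Rle_lt_trans with (2 := Hn), Rle_abs.
Qed.

Lemma sequence_sup (u : nat -> R) M :
  (forall n, u n <= M) ->
  exists l, l <= M /\ (forall n, u n <= l) /\ (forall x, x < l -> exists n, x < u n).
Proof.
intros HM.
destruct (completeness (fun x => exists n, x = u n)) as [l [Hub Hlub]].
- exists M. intros x [n ->]. apply HM.
- exists (u 0%nat). now exists 0%nat.
- exists l. split; [|split].
  + apply Hlub. intros x [n ->]. apply HM.
  + intros n. apply Hub. now exists n.
  + intros x Hx. apply Classical_Pred_Type.not_all_not_ex. intros HN.
    apply (Rlt_not_le _ _ Hx), Hlub. intros y [n ->].
    specialize (HN n). lra.
Qed.

Lemma sequence_inf (u : nat -> R) M :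
  (forall n, M <= u n) ->
  exists l, M <= l /\ (forall n, l <= u n) /\ (forall x, l < x -> exists n, u n < x).
Proof.
intros HM. destruct (sequence_sup (fun n => - u n) (- M)) as (l & H1 & H2 & H3).
- intros n. specialize (HM n). lra.
- exists (- l). split; [lra|split].
  + intros n. specialize (H2 n). lra.
  + intros x Hx. destruct (H3 (- x)) as [n Hn]; [lra|]. exists n. lra.
Qed.

Lemma continuous_polynomial (a : nat -> R) n x :
  continuity_pt (fun y => sum_f_R0 (fun i => a i * y ^ i) n) x.
Proof.
assert (Hm : forall i, continuity_pt (fun y => a i * y ^ i) x).
{ intros i. apply derivable_continuous_pt. apply derivable_pt_mult.
  - apply derivable_pt_const.
  - apply derivable_pt_pow. }
induction n as [|n IH]; [apply Hm|]. now apply continuity_pt_plus.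
Qed.

Lemma cfun_name_continuous p f x e :
  cfun_name p f -> 0 <= x <= 1 -> 0 < e ->
  exists d, 0 < d /\
    forall y, 0 <= y <= 1 -> Rabs (y - x) < d -> Rabs (f y - f x) < e.
Proof.
intros Hp Hx He.
destruct (inv_pow2_small (e / 4)) as [n Hn]; [lra|].
destruct (continuous_polynomial (fun i => qr (p (Cantor.to_nat (n, S i))))
  (p (Cantor.to_nat (n, 0%nat))) x (e / 4)) as [d [Hd Hxd]]; [lra|].
exists d. split; [exact Hd|]. intros y Hy Hyx.
assert (Hfx := Hp n x Hx). assert (Hfy := Hp n y Hy).
assert (Hpoly : Rabs (approx_poly p n y - approx_poly p n x) < e / 4).
(* The library's notion of continuity at x speaks only about points different from x. *)
{ destruct (Req_dec x y) as [<-|Hne].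
  - unfold Rminus. rewrite Rplus_opp_r, Rabs_R0. lra.
  - apply (Hxd y). repeat split; [exact Hne|exact Hyx]. }
revert Hfx Hfy Hpoly. unfold Rabs. repeat destruct Rcase_abs; lra.
Qed.

(** Near x the function changes by less than |f x| and so keeps its sign. The factor c selects which
    sign is excluded. *)
Lemma closed_sign_condition p f x c :
  cfun_name p f -> 0 <= x <= 1 ->
  (forall d, 0 < d -> exists y, 0 <= y <= 1 /\ Rabs (y - x) < d /\ f y * c <= 0) ->
  f x * c <= 0.
Proof.
intros Hp Hx Hy. apply Rnot_lt_le. intros Hpos.
assert (Hfx : 0 < Rabs (f x)) by (apply Rabs_pos_lt; nra).
destruct (cfun_name_continuous p f x _ Hp Hx Hfx) as (d & Hd & Hc).
destruct (Hy d Hd) as (y & Hy1 & Hyx & Hfy).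
specialize (Hc y Hy1 Hyx). revert Hc. unfold Rabs. repeat destruct Rcase_abs; nra.
Qed.

(** * Reduction of IVT to interval choice by certified brackets *)

Definition qone : nat := qfrac 1 1.
Definition qpow2_inv (k : nat) : nat := qfrac 1 (2 ^ k).

Definition approx_code (p : Baire) (k c : nat) : nat :=
  qsum (fun i => qmul (p (pairn k (S i))) (qpow c i)) (p (pairn k 0)).

(** The k-th polynomial is within 2^-k of the function, so a value beyond that margin certifies a
    strict sign. *)
Definition opposite (p : Baire) (k c d : nat) : bool :=
  (qltb (qpow2_inv k) (approx_code p k c)
     && qltb (approx_code p k d) (qopp (qpow2_inv k))
   || qltb (approx_code p k c) (qopp (qpow2_inv k))
     && qltb (qpow2_inv k) (approx_code p k d))%bool.

Definition bracket_step (p : Baire) (k c r : nat) : nat :=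
  if (qltb (fstn r) c && qltb c (sndn r))%bool then
    if opposite p k c 0 then pairn (fstn r) c
    else if opposite p k c qone then pairn c (sndn r) else r
  else r.

(** Stage s tries the candidate and the precision paired in s, so every such pair gets its turn. *)
Definition bracket (p : Baire) (s : nat) : nat :=
  nat_rect (fun _ => nat) (pairn 0 qone)
    (fun s r => bracket_step p (sndn s) (fstn s) r) s.

(** Even entries remove what lies left of the bracket, odd ones what lies right of it. The outer
    ends -1 and 2 lie outside [[0,1]], so that 0 and 1 can be removed too. *)
Definition bracket_complement (p : Baire) (n : nat) : nat :=
  if Nat.even n then pairn (qopp qone) (fstn (bracket p n))
  else pairn (sndn (bracket p n)) (qfrac 2 1).

Section Computability.
Context (k : nat) (A B : Baire -> list nat -> nat)
  (HA : computable k A) (HB : computable k B).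

Lemma computable_qpow2_inv : computable k (fun p xs => qpow2_inv (A p xs)).
Proof. unfold qpow2_inv. computability. Qed.

Lemma computable_approx_code :
  computable k (fun p xs => approx_code p (A p xs) (B p xs)).
Proof.
unfold approx_code.
apply computable_qsum with
  (F := fun p i xs => qmul (p (pairn (A p xs) (S i))) (qpow (B p xs) i)); computability.
Qed.
End Computability.
Hint Resolve computable_qpow2_inv computable_approx_code : computable.

Lemma computable_bracket_complement :
  computable 1 (fun p xs => bracket_complement p (hd 0%nat xs)).
Proof.
unfold bracket_complement, bracket, bracket_step, opposite. computability.
Qed.

Lemma qr_qone : qr qone = 1.
Proof. unfold qone. rewrite qr_qfrac by lia. simpl. field. Qed.

Lemma qr_qpow2_inv k : qr (qpow2_inv k) = / 2 ^ k.
Proof.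
unfold qpow2_inv. rewrite qr_qfrac, pow_INR by (apply Nat.neq_0_lt_0, Nat.pow_nonzero; lia).
simpl (INR 1). simpl (INR 2). unfold Rdiv. rewrite Rmult_1_l. reflexivity.
Qed.

Lemma qr_approx_code p k c : qr (approx_code p k c) = approx_poly p k (qr c).
Proof.
unfold approx_code, approx_poly. rewrite qr_qsum. apply sum_eq. intros i _.
now rewrite qr_qmul, qr_qpow.
Qed.

Lemma Rabs_le_between x e : Rabs x <= e -> - e <= x <= e.
Proof. unfold Rabs. destruct Rcase_abs; lra. Qed.

Lemma opposite_sound p f k c d :
  cfun_name p f -> 0 <= qr c <= 1 -> 0 <= qr d <= 1 ->
  opposite p k c d = true -> f (qr c) * f (qr d) < 0.
Proof.
intros Hp Hc Hd. specialize (Hp k).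
assert (Hc' := Hp _ Hc). assert (Hd' := Hp _ Hd). revert Hc' Hd'. unfold opposite.
rewrite <- !qr_approx_code, <- !qr_qpow2_inv.
intros Hc' Hd'. apply Rabs_le_between in Hc', Hd'.
repeat match goal with |- context [qltb ?a ?b] => destruct (qltb_spec a b) end;
  simpl; intros E; try discriminate; rewrite ?qr_qopp in *; nra.
Qed.

Lemma opposite_complete p f c d :
  cfun_name p f -> 0 <= qr c <= 1 -> 0 <= qr d <= 1 ->
  f (qr c) * f (qr d) < 0 -> exists k, opposite p k c d = true.
Proof.
intros Hp Hc Hd Hcd.
(* With both absolute values above 2 * 2^-k, the approximations still exceed the margin 2^-k after
   an error of 2^-k. *)
destruct (inv_pow2_small (Rmin (Rabs (f (qr c))) (Rabs (f (qr d))) / 2)) as [k Hk].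
{ assert (0 < Rmin (Rabs (f (qr c))) (Rabs (f (qr d)))); [|lra].
  apply Rmin_pos; apply Rabs_pos_lt; nra. }
exists k. specialize (Hp k).
assert (Hc' := Hp _ Hc). assert (Hd' := Hp _ Hd). revert Hc' Hd' Hk. unfold opposite.
rewrite <- !qr_approx_code, <- !qr_qpow2_inv.
intros Hc' Hd' Hk. apply Rabs_le_between in Hc', Hd'.
pose proof (Rmin_l (Rabs (f (qr c))) (Rabs (f (qr d)))) as M1.
pose proof (Rmin_r (Rabs (f (qr c))) (Rabs (f (qr d)))) as M2.
assert (N1 : 2 * qr (qpow2_inv k) < Rabs (f (qr c))) by lra.
assert (N2 : 2 * qr (qpow2_inv k) < Rabs (f (qr d))) by lra.
clear M1 M2 Hk. unfold Rabs in N1, N2.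
repeat match goal with |- context [qltb ?a ?b] => destruct (qltb_spec a b) end;
  simpl; try reflexivity; rewrite ?qr_qopp in *;
  repeat destruct Rcase_abs; exfalso; nra.
Qed.

Lemma in_rat_interval_pairn i j x :
  in_rat_interval (pairn i j) x <-> (qr i < x < qr j /\ 0 <= x <= 1).
Proof. unfold in_rat_interval, pairn. now rewrite Cantor.cancel_of_to. Qed.

(** The product of [x * y] and [x * z] is x^2 times the negative number [y * z], so the two cannot
    both be nonnegative. *)
Lemma opposite_to_one_of x y z : x <> 0 -> y * z < 0 -> x * y < 0 \/ x * z < 0.
Proof.
intros Hx Hyz. pose proof (Rsqr_pos_lt x Hx) as Hxx. unfold Rsqr in Hxx.
destruct (Rlt_le_dec (x * y) 0) as [L|L]; [now left|].
right. apply Rnot_le_lt. intros H. pose proof (Rmult_le_pos _ _ L H). nra.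
Qed.

Section Bracket.
Context (p : Baire) (f : R -> R) (Hp : cfun_name p f) (Hf : f 0 * f 1 < 0).

Let lo s := qr (fstn (bracket p s)).
Let hi s := qr (sndn (bracket p s)).

Lemma bracket_S s :
  bracket p (S s) = bracket_step p (sndn s) (fstn s) (bracket p s).
Proof. reflexivity. Qed.

(** The left end keeps the sign of [f 0] and the right end that of [f 1]; this is phrased as
    opposition to the other end because that is what [opposite] certifies. *)
Lemma bracket_invariant s :
  0 <= lo s /\ lo s < hi s /\ hi s <= 1 /\ f (lo s) * f 1 < 0 /\ f (hi s) * f 0 < 0.
Proof.
unfold lo, hi. induction s as [|s IH].
- change (bracket p 0) with (pairn 0 qone). rewrite fstn_pairn, sndn_pairn, qr_0, qr_qone.
  lra.
- rewrite bracket_S. unfold bracket_step.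
  destruct (qltb_spec (fstn (bracket p s)) (fstn s)); cbn [andb]; [|exact IH].
  destruct (qltb_spec (fstn s) (sndn (bracket p s))); [|exact IH].
  destruct (opposite p (sndn s) (fstn s) 0) eqn:E0.
  { apply (opposite_sound p f) in E0; rewrite ?qr_0 in *; [|easy|lra..].
    rewrite fstn_pairn, sndn_pairn. lra. }
  destruct (opposite p (sndn s) (fstn s) qone) eqn:E1; [|exact IH].
  apply (opposite_sound p f) in E1; rewrite ?qr_qone in *; [|easy|lra..].
  rewrite fstn_pairn, sndn_pairn. lra.
Qed.

Lemma bracket_shrinks s : lo s <= lo (S s) /\ hi (S s) <= hi s.
Proof.
unfold lo, hi. rewrite bracket_S. unfold bracket_step.
destruct (qltb_spec (fstn (bracket p s)) (fstn s)); cbn [andb]; [|lra].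
destruct (qltb_spec (fstn s) (sndn (bracket p s))); [|lra].
destruct opposite; [|destruct opposite]; rewrite ?fstn_pairn, ?sndn_pairn; lra.
Qed.

Lemma bracket_mono m n : (m <= n)%nat -> lo m <= lo n /\ hi n <= hi m.
Proof. induction 1 as [|n _ IH]; [lra|]. pose proof (bracket_shrinks n). lra. Qed.

(** A nonzero value is opposite to [f 0] or to [f 1], and some precision k certifies it. At stage
    [pairn c k] the candidate, if still inside, becomes an endpoint and is strictly inside no
    longer. *)
Lemma bracket_excludes_nonzero c :
  f (qr c) <> 0 -> ~ (forall s, lo s < qr c < hi s).
Proof.
intros Hc Hs. pose proof (Hs 0%nat) as H0. pose proof (bracket_invariant 0) as I0.
assert (exists k, opposite p k c 0 = true \/ opposite p k c qone = true) as [k Hk].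
{ unfold lo, hi in *. destruct (opposite_to_one_of _ _ _ Hc Hf) as [L|L].
  - destruct (opposite_complete p f c 0 Hp) as [k Hk];
      [lra|rewrite qr_0; lra|now rewrite qr_0|now exists k; left].
  - destruct (opposite_complete p f c qone Hp) as [k Hk];
      [lra|rewrite qr_qone; lra|now rewrite qr_qone|now exists k; right]. }
specialize (Hs (S (pairn c k))) as H1. specialize (Hs (pairn c k)). revert H1. unfold lo, hi in *.
rewrite bracket_S, fstn_pairn, sndn_pairn. unfold bracket_step.
destruct (qltb_spec (fstn (bracket p (pairn c k))) c); [cbn [andb]|lra].
destruct (qltb_spec c (sndn (bracket p (pairn c k)))); [|lra].
destruct (opposite p k c 0).
- rewrite sndn_pairn. lra.
- destruct (opposite p k c qone); [|now destruct Hk].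
  rewrite fstn_pairn. lra.
Qed.

Lemma bracket_complement_spec :
  exists A, closed_name (bracket_complement p) A /\ pdom C_I A /\
    forall x, A x -> 0 <= x <= 1 /\ f x = 0.
Proof.
destruct (sequence_sup lo 1) as (a & Ha1 & Ha & Ha').
{ intros s. pose proof (bracket_invariant s). lra. }
destruct (sequence_inf hi a) as (b & Hab & Hb & Hb').
{ intros s. apply Rnot_lt_le. intros H. destruct (Ha' _ H) as [t Ht].
  pose proof (bracket_mono _ _ (Nat.le_max_l s t)).
  pose proof (bracket_mono _ _ (Nat.le_max_r s t)).
  pose proof (bracket_invariant (Nat.max s t)). lra. }
assert (0 <= a) as Ha0.
{ pose proof (bracket_invariant 0). specialize (Ha 0%nat). lra. }
assert (b <= 1) as Hb1.
{ pose proof (bracket_invariant 0). specialize (Hb 0%nat). lra. }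
exists (fun x => a <= x <= b). split; [split|split].
- intros x Hx. lra.
- intros x. split.
  + intros [Hx HA]. destruct (Rlt_dec x a) as [L|L].
    (* Left intervals sit at even positions; the bracket at stage 2s is at least as tight as the one
       at stage s. *)
    * destruct (Ha' _ L) as [s Hs]. exists (2 * s)%nat. unfold bracket_complement.
      rewrite Nat.even_even, in_rat_interval_pairn, qr_qopp, qr_qone.
      pose proof (bracket_mono s (2 * s) ltac:(lia)). unfold lo in *. lra.
    * destruct (Hb' x) as [s Hs]; [lra|]. exists (S (2 * s)). unfold bracket_complement.
      rewrite Nat.even_succ, Nat.odd_even, in_rat_interval_pairn, qr_qfrac by lia.
      pose proof (bracket_mono s (S (2 * s)) ltac:(lia)). unfold hi in *. simpl (INR _). lra.
  + intros [n Hn]. revert Hn. unfold bracket_complement.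
    specialize (Ha n). specialize (Hb n). unfold lo, hi in *.
    destruct (Nat.even n); rewrite in_rat_interval_pairn; lra.
- exists a, b. repeat split; lra.
- intros x Hx. split; [lra|].
  assert (HaN : f a * f 1 <= 0).
  { apply (closed_sign_condition p); [easy|lra|]. intros d Hd.
    destruct (Ha' (a - d)) as [s Hs]; [lra|]. exists (lo s).
    pose proof (bracket_invariant s). specialize (Ha s).
    split; [lra|split; [|lra]]. apply Rabs_def1; lra. }
  assert (HbN : f b * f 0 <= 0).
  { apply (closed_sign_condition p); [easy|lra|]. intros d Hd.
    destruct (Hb' (b + d)) as [s Hs]; [lra|]. exists (hi s).
    pose proof (bracket_invariant s). specialize (Hb s).
    split; [lra|split; [|lra]]. apply Rabs_def1; lra. }
  (* If the limits coincide, a nonzero value there would be opposite to [f 0] or [f 1], against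
     [HaN] and [HbN]. *)
  destruct (Req_dec a b) as [<-|Hne].
  { replace x with a by lra. destruct (Req_dec (f a) 0) as [E|E]; [exact E|].
    destruct (opposite_to_one_of _ _ _ E Hf); nra. }
  (* Rationals strictly between a and b are zeros and come arbitrarily close to x. The factors 1 and
     -1 then give both inequalities for [f x]. *)
  assert (Hx0 : forall c, f x * c <= 0).
  { intros c. apply (closed_sign_condition p); [easy|lra|]. intros d Hd.
    destruct (qr_dense (Rmax a (x - d)) (Rmin b (x + d))) as [q Hq].
    - split; [apply Rle_trans with (2 := Rmax_l _ _); lra|].
      apply Rmax_lub_lt; apply Rmin_glb_lt; lra.
    - pose proof (Rmax_l a (x - d)). pose proof (Rmax_r a (x - d)).
      pose proof (Rmin_l b (x + d)). pose proof (Rmin_r b (x + d)).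
      exists (qr q). split; [lra|split; [apply Rabs_def1; lra|]].
      destruct (Req_dec (f (qr q)) 0) as [E|E]; [rewrite E; lra|].
      destruct (bracket_excludes_nonzero q E). intros s.
      specialize (Ha s). specialize (Hb s). lra. }
  pose proof (Hx0 1). pose proof (Hx0 (-1)). lra.
Qed.
End Bracket.

Lemma IVT_le_C_I : sW_le IVT C_I.
Proof.
apply sW_le_intro with (H := fun r n => r n) (K := bracket_complement).
- computability.
- apply computable_bracket_complement.
- intros p f Hp Hf. destruct (bracket_complement_spec p f Hp Hf) as (A & HA & HI & Hz).
  exists A. split; [exact HA|split; [exact HI|]].
  intros r w Hr Hw. exists w. split; [exact Hr|]. exact (Hz w Hw).
Qed.

(** * Bernstein polynomials and their error on Lipschitz functions *)

(* De Casteljau's recursion on the samples [F 0], ..., [F N]. *)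
Fixpoint bernstein (N : nat) (F : nat -> R) (x : R) : R :=
  match N with
  | O => F 0%nat
  | S N => (1 - x) * bernstein N F x + x * bernstein N (fun k => F (S k)) x
  end.

Lemma bernstein_le N F G x :
  0 <= x <= 1 -> (forall k, (k <= N)%nat -> F k <= G k) ->
  bernstein N F x <= bernstein N G x.
Proof.
intros Hx. revert F G. induction N as [|N IH]; intros F G H; simpl; [now apply H|].
apply Rplus_le_compat; apply Rmult_le_compat_l; try lra; apply IH; intros; apply H; lia.
Qed.

Lemma bernstein_linear N a b F G x :
  bernstein N (fun k => a * F k + b * G k) x = a * bernstein N F x + b * bernstein N G x.
Proof.
revert F G. induction N as [|N IH]; intros F G; simpl; [ring|].
rewrite IH, (IH (fun k => F (S k)) (fun k => G (S k))). ring.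
Qed.

Lemma bernstein_ext N F G x :
  (forall k, F k = G k) -> bernstein N F x = bernstein N G x.
Proof.
revert F G. induction N as [|N IH]; intros F G H; simpl; [apply H|].
now rewrite (IH F G), (IH (fun k => F (S k)) (fun k => G (S k))).
Qed.

Lemma bernstein_const N c x : bernstein N (fun _ => c) x = c.
Proof. induction N as [|N IH]; simpl; [|rewrite IH]; ring. Qed.

(** [bernstein N F x] is the expectation of F under the binomial distribution with N trials and
    success probability x; this is its mean. *)
Lemma bernstein_INR N x : bernstein N INR x = INR N * x.
Proof.
induction N as [|N IH]; [simpl; ring|]. cbn [bernstein].
rewrite (bernstein_ext N (fun k => INR (S k)) (fun k => 1 * INR k + 1 * 1))
  by (intros; rewrite S_INR; ring).
rewrite (bernstein_linear N 1 1 INR (fun _ => 1)), bernstein_const, IH, S_INR. ring.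
Qed.

Lemma bernstein_square N x :
  bernstein N (fun k => INR k * INR k) x = INR N * x * (1 - x) + (INR N * x) * (INR N * x).
Proof.
induction N as [|N IH]; [simpl; ring|]. cbn [bernstein].
rewrite (bernstein_ext N (fun k => INR (S k) * INR (S k))
          (fun k => 1 * (INR k * INR k) + 1 * (2 * INR k + 1 * 1)))
  by (intros; rewrite S_INR; ring).
rewrite (bernstein_linear N 1 1 (fun k => INR k * INR k) (fun k => 2 * INR k + 1 * 1)),
  (bernstein_linear N 2 1 INR (fun _ => 1)), bernstein_const, bernstein_INR, IH, S_INR. ring.
Qed.

(** The variance of the binomial distribution, by expanding the square into the moments already
    computed. *)
Lemma bernstein_variance N x :
  bernstein N (fun k => (INR k - INR N * x) * (INR k - INR N * x)) x = INR N * x * (1 - x).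
Proof.
rewrite (bernstein_ext N _ (fun k => 1 * (INR k * INR k) +
   1 * (- (2 * INR N * x) * INR k + (INR N * x * (INR N * x)) * 1))) by (intros; ring).
rewrite (bernstein_linear N 1 1 (fun k => INR k * INR k)
   (fun k => - (2 * INR N * x) * INR k + (INR N * x * (INR N * x)) * 1)),
  (bernstein_linear N _ _ INR (fun _ => 1)), bernstein_const, bernstein_INR, bernstein_square.
ring.
Qed.

(* AM-GM bounds [|k/N - x|] by [(e + (k/N - x)^2 / e) / 2] with [e = 2^-m = N^(-1/2)];
   the second term averages to the variance. *)
Lemma bernstein_upper m L F g x :
  0 <= L -> 0 <= x <= 1 ->
  (forall k, F k <= g + L * Rabs (INR k / INR (4 ^ m) - x)) ->
  bernstein (4 ^ m) F x <= g + L * / 2 ^ m.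
Proof.
intros HL Hx HF. set (N := (4 ^ m)%nat) in *. set (e := / 2 ^ m).
assert (He : 0 < e) by apply inv_pow2_pos.
assert (HN : INR N = / (e * e)).
{ unfold N, e. rewrite pow_INR, Rinv_mult, !Rinv_inv, <- Rpow_mult_distr. f_equal. simpl. ring. }
assert (HNe : INR N * (e * e) = 1) by (rewrite HN; field; lra).
(* The quadratic term L u^2 / (2e) becomes c (k - Nx)^2 because u = e^2 (k - Nx). *)
clearbody e N. set (c := L * e * e * e / 2).
apply Rle_trans with (bernstein N (fun k => 1 * (g + L * e / 2) +
   c * ((INR k - INR N * x) * (INR k - INR N * x))) x).
- apply bernstein_le; [exact Hx|]. intros k _. apply Rle_trans with (1 := HF k).
  assert (E : INR k - INR N * x = (INR k / INR N - x) / (e * e)).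
  { rewrite HN. field. lra. }
  rewrite E. set (u := INR k / INR N - x).
  assert (A : Rabs u <= e / 2 + u * u / (2 * e)).
  { assert (0 <= (Rabs u - e) * (Rabs u - e) / (2 * e)).
    { apply Rmult_le_pos; [apply Rle_0_sqr|]. left. apply Rinv_0_lt_compat. lra. }
    replace (u * u) with (Rabs u * Rabs u)
      by (rewrite <- Rabs_mult; apply Rabs_right, Rle_ge, Rle_0_sqr).
    replace (e / 2 + Rabs u * Rabs u / (2 * e))
      with (Rabs u + (Rabs u - e) * (Rabs u - e) / (2 * e)) by (field; lra). lra. }
  apply Rmult_le_compat_l with (r := L) in A; [|exact HL].
  replace (c * (u / (e * e) * (u / (e * e)))) with (L * (u * u / (2 * e)))
    by (unfold c; field; lra). lra.
- rewrite (bernstein_linear N 1 c (fun _ => g + L * e / 2)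
    (fun k => (INR k - INR N * x) * (INR k - INR N * x))), bernstein_const, bernstein_variance.
  replace (c * (INR N * x * (1 - x))) with (L * e / 2 * (INR N * (e * e)) * (x * (1 - x)))
    by (unfold c; field).
  rewrite HNe. assert (0 <= L * e) by nra. assert (0 <= x * (1 - x) <= 1) by nra. nra.
Qed.

Lemma bernstein_approx m L g x :
  0 <= L -> 0 <= x <= 1 -> (forall y, Rabs (g y - g x) <= L * Rabs (y - x)) ->
  Rabs (bernstein (4 ^ m) (fun k => g (INR k / INR (4 ^ m))) x - g x) <= L * / 2 ^ m.
Proof.
intros HL Hx Hg. set (F := fun k => g (INR k / INR (4 ^ m))).
assert (U : bernstein (4 ^ m) F x <= g x + L * / 2 ^ m).
{ apply bernstein_upper; [easy..|]. intros k. specialize (Hg (INR k / INR (4 ^ m))).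
  apply Rabs_le_between in Hg. unfold F. lra. }
(* The lower bound is the upper bound for -g; the summand [0 * 0] gives the samples the shape of
   [bernstein_linear]. *)
assert (D : bernstein (4 ^ m) (fun k => (-1) * F k + 0 * 0) x <= - g x + L * / 2 ^ m).
{ apply bernstein_upper; [easy..|]. intros k. specialize (Hg (INR k / INR (4 ^ m))).
  apply Rabs_le_between in Hg. unfold F. lra. }
rewrite (bernstein_linear _ (-1) 0 F (fun _ => 0)) in D.
apply Rabs_le. lra.
Qed.

(** * Monomial coefficients of Bernstein polynomials *)

Fixpoint binom (n j : nat) : R :=
  match j with
  | O => 1
  | S j => binom n j * (INR n - INR j) / INR (S j)
  end.

Lemma binom_pascal n j : binom (S n) (S j) = binom n j + binom n (S j).
Proof.
induction j as [|j IH].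
- cbn [binom]. rewrite S_INR. simpl (INR 0). simpl (INR 1). field.
- change (binom (S n) (S (S j)))
    with (binom (S n) (S j) * (INR (S n) - INR (S j)) / INR (S (S j))).
  rewrite IH. cbn [binom]. rewrite !S_INR. pose proof (pos_INR j). field. lra.
Qed.

Lemma binom_diag n : binom n (S n) = 0.
Proof. cbn [binom]. unfold Rminus. rewrite Rplus_opp_r. unfold Rdiv. ring. Qed.

(** Pascal's rule under a sum; [binom_diag] removes the surplus top term. It serves both the forward
    differences and the monomial expansion. *)
Lemma binom_sum_S n a :
  sum_f_R0 (fun j => binom (S n) j * a j) (S n) =
  sum_f_R0 (fun j => binom n j * a j) n + sum_f_R0 (fun j => binom n j * a (S j)) n.
Proof.
rewrite decomp_sum by lia. cbn [pred].
rewrite (sum_eq _ (fun j => binom n j * a (S j) + binom n (S j) * a (S j)))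
  by (intros; rewrite binom_pascal; ring).
rewrite sum_plus.
pose proof (decomp_sum (fun j => binom n j * a j) (S n) ltac:(lia)) as E.
cbn [pred] in E. rewrite tech5, binom_diag in E. cbn [binom] in *. lra.
Qed.

(** The j-th forward difference at 0; the sign exponent j + k has the parity of j - k and avoids
    truncated subtraction. *)
Definition difference (j : nat) (F : nat -> R) : R :=
  sum_f_R0 (fun k => binom j k * ((-1) ^ (j + k) * F k)) j.

Lemma difference_S j F :
  difference (S j) F = difference j (fun k => F (S k)) - difference j F.
Proof.
unfold difference. rewrite (binom_sum_S j (fun k => (-1) ^ (S j + k) * F k)).
rewrite <- minus_sum, <- sum_plus. apply sum_eq. intros k _.
replace (S j + S k)%nat with (S (S (j + k))) by lia. simpl. ring.
Qed.

(** One recursion step is F plus x times the forward difference of F, so N steps expand binomially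
    in powers of x. *)
Lemma bernstein_monomials N F x :
  bernstein N F x = sum_f_R0 (fun j => binom N j * difference j F * x ^ j) N.
Proof.
revert F. induction N as [|N IH]; intros F.
- unfold difference. simpl. ring.
- rewrite (sum_eq _ (fun j => binom (S N) j * (difference j F * x ^ j))) by (intros; ring).
  rewrite binom_sum_S. cbn [bernstein]. rewrite (IH F), (IH (fun k => F (S k))).
  rewrite (sum_eq (fun j => binom N j * (difference (S j) F * x ^ S j))
    (fun j => binom N j * difference j (fun k => F (S k)) * x ^ j * x -
              binom N j * difference j F * x ^ j * x))
    by (intros; rewrite difference_S; simpl; ring).
  rewrite minus_sum, <- !scal_sum.
  rewrite (sum_eq (fun j => binom N j * (difference j F * x ^ j))
     (fun j => binom N j * difference j F * x ^ j)) by (intros; ring). ring.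
Qed.

(** * Codes for the function built from a closed interval *)

Definition lower_end (p : Baire) (s : nat) : nat :=
  nat_rect (fun _ => nat) 0%nat (fun s c =>
    if (qltb (fstn (p (fstn s))) c && qltb c (sndn (p (fstn s))))%bool
    then sndn (p (fstn s)) else c) s.

(** As in [lower_end], stage s inspects the listed interval number [fstn s], so each interval is
    inspected at infinitely many stages. *)
Definition upper_end (p : Baire) (s : nat) : nat :=
  nat_rect (fun _ => nat) qone (fun s d =>
    if (qltb (fstn (p (fstn s))) d && qltb d (sndn (p (fstn s))))%bool
    then fstn (p (fstn s)) else d) s.

Definition hinge_code (t c d : nat) : nat := qsub (qmax0 (qsub t d)) (qmax0 (qsub c t)).

Definition hinge_sum_code (p : Baire) (n t : nat) : nat :=
  qsum (fun s => qmul (qpow2_inv (S s)) (hinge_code t (lower_end p s) (upper_end p s))) n.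

Definition qbinom (n j : nat) : nat :=
  nat_rect (fun _ => nat) qone
    (fun j r => qmul r (qmul (qsub (qfrac n 1) (qfrac j 1)) (qfrac 1 (S j)))) j.

Definition qsign (m : nat) : nat := if Nat.even m then qone else qopp qone.

(** Degree 4^(n+4) makes the Bernstein error 6 * 2^-(n+4), and stopping the series at index n+1
    costs at most 2^-(n+1); together this is below 2^-n. *)
Definition coefficient_code (p : Baire) (n j : nat) : nat :=
  qmul (qbinom (4 ^ (n + 4)) j)
    (qsum (fun k => qmul (qbinom j k) (qmul (qsign (j + k))
       (hinge_sum_code p (S n) (qsub (qfrac (3 * k) (4 ^ (n + 4))) qone)))) j).

Definition hinge_name (p : Baire) (m : nat) : nat :=
  if (0 <? sndn m)%nat then coefficient_code p (fstn m) (pred (sndn m))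
  else (4 ^ (fstn m + 4))%nat.

(** Two extra digits of precision absorb the factor 3. *)
Definition triple_minus_one (r : Baire) (n : nat) : nat :=
  qsub (qmul (qfrac 3 1) (r (n + 2)%nat)) qone.

Section Computability.
Context (k : nat) (A B C : Baire -> list nat -> nat)
  (HA : computable k A) (HB : computable k B) (HC : computable k C).

Lemma computable_lower_end : computable k (fun p xs => lower_end p (A p xs)).
Proof. unfold lower_end. computability. Qed.

Lemma computable_upper_end : computable k (fun p xs => upper_end p (A p xs)).
Proof. unfold upper_end. computability. Qed.

Lemma computable_hinge_code :
  computable k (fun p xs => hinge_code (A p xs) (B p xs) (C p xs)).
Proof. unfold hinge_code. computability. Qed.

Lemma computable_qbinom : computable k (fun p xs => qbinom (A p xs) (B p xs)).
Proof. unfold qbinom. computability. Qed.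

Lemma computable_qsign : computable k (fun p xs => qsign (A p xs)).
Proof. unfold qsign. computability. Qed.
End Computability.
Hint Resolve computable_lower_end computable_upper_end computable_hinge_code
  computable_qbinom computable_qsign : computable.

Lemma computable_hinge_sum_code k A B :
  computable k A -> computable k B ->
  computable k (fun p xs => hinge_sum_code p (A p xs) (B p xs)).
Proof. intros HA HB. unfold hinge_sum_code. computability. Qed.
Hint Resolve computable_hinge_sum_code : computable.

Lemma computable_hinge_name : computable 1 (fun p xs => hinge_name p (hd 0%nat xs)).
Proof. unfold hinge_name, coefficient_code. computability. Qed.

Lemma computable_triple_minus_one :
  computable 1 (fun r xs => triple_minus_one r (hd 0%nat xs)).
Proof. unfold triple_minus_one. computability. Qed.

(** * Limits of rapidly converging series *)

Lemma rapid_sequence_limit (u : nat -> R) :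
  (forall n, Rabs (u (S n) - u n) <= / 2 ^ S n) ->
  {l | forall n, Rabs (u n - l) <= / 2 ^ n}.
Proof.
intros Hu.
(* The intervals of radius 2^-n around [u n] are nested; the supremum of their left ends lies in all
   of them. *)
assert (Hmono : forall m n, (m <= n)%nat ->
   u m - / 2 ^ m <= u n - / 2 ^ n /\ u n + / 2 ^ n <= u m + / 2 ^ m).
{ induction 1 as [|n _ IH]; [lra|]. specialize (Hu n). apply Rabs_le_between in Hu.
  rewrite inv_pow2_S in *. lra. }
assert (Hcross : forall m n, u m - / 2 ^ m <= u n + / 2 ^ n).
{ intros m n.
  pose proof (Hmono _ _ (Nat.le_max_l m n)). pose proof (Hmono _ _ (Nat.le_max_r m n)).
  pose proof (inv_pow2_pos (Nat.max m n)). lra. }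
destruct (completeness (fun x => exists n, x = u n - / 2 ^ n)) as [l [Hub Hlub]].
- exists (u 0%nat + / 2 ^ 0). intros x [n ->]. apply Hcross.
- exists (u 0%nat - / 2 ^ 0). now exists 0%nat.
- exists l. intros n.
  assert (u n - / 2 ^ n <= l) by (apply Hub; now exists n).
  assert (l <= u n + / 2 ^ n) by (apply Hlub; intros x [m ->]; apply Hcross).
  apply Rabs_le. lra.
Qed.

Lemma negative_series_limit (a : nat -> R) l s :
  (forall n, Rabs (sum_f_R0 a n - l) <= / 2 ^ n) ->
  (forall i, a i <= 0) -> a s < 0 -> l < 0.
Proof.
intros Hl Ha Hs.
assert (Hn : forall n, sum_f_R0 a n <= 0).
{ induction n as [|n IH]; simpl; [apply Ha|]. specialize (Ha (S n)). lra. }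
assert (Hsum : forall n, (s <= n)%nat -> sum_f_R0 a n <= a s).
{ induction 1 as [|n _ IH].
  - destruct s as [|s]; simpl; [lra|]. specialize (Hn s). lra.
  - simpl. specialize (Ha (S n)). lra. }
destruct (inv_pow2_small (- a s)) as [n Hsmall]; [lra|].
assert (Hle : / 2 ^ (n + s) <= / 2 ^ n).
{ apply Rinv_le_contravar; [apply pow_lt; lra|]. apply Rle_pow; [lra|lia]. }
(* Index n + s is past s, where the partial sum is at most [a s], and its error is below [- a s]. *)
specialize (Hl (n + s)%nat). specialize (Hsum (n + s)%nat ltac:(lia)).
apply Rabs_le_between in Hl. lra.
Qed.

Lemma positive_series_limit (a : nat -> R) l s :
  (forall n, Rabs (sum_f_R0 a n - l) <= / 2 ^ n) ->
  (forall i, 0 <= a i) -> 0 < a s -> 0 < l.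
Proof.
intros Hl Ha Hs.
enough (- l < 0) by lra. apply (negative_series_limit (fun i => a i * -1) (- l) s).
- intros n. rewrite <- scal_sum. specialize (Hl n).
  rewrite <- Rabs_Ropp. now replace (- (-1 * sum_f_R0 a n - - l)) with (sum_f_R0 a n - l) by ring.
- intros i. specialize (Ha i). lra.
- lra.
Qed.

(** * The hinge function and its weighted sums *)

Definition hinge (t c d : R) : R := Rmax 0 (t - d) - Rmax 0 (c - t).

(** The range of t is the image of [[0,1]] under 3x - 1. *)
Lemma hinge_bound t c d :
  -1 <= t <= 2 -> 0 <= c <= 1 -> 0 <= d <= 1 -> Rabs (hinge t c d) <= 2.
Proof.
intros. unfold hinge, Rmax. repeat destruct Rle_dec; apply Rabs_le; lra.
Qed.

Lemma hinge_lipschitz t t' c d :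
  Rabs (hinge t c d - hinge t' c d) <= 2 * Rabs (t - t').
Proof.
unfold hinge, Rmax. repeat destruct Rle_dec; unfold Rabs; repeat destruct Rcase_abs; lra.
Qed.

Definition hinge_sum (c d : nat -> R) (n : nat) (t : R) : R :=
  sum_f_R0 (fun s => / 2 ^ S s * hinge t (c s) (d s)) n.

Lemma hinge_sum_lipschitz c d n t t' :
  Rabs (hinge_sum c d n t - hinge_sum c d n t') <= 2 * Rabs (t - t').
Proof.
(* Each hinge is 2-Lipschitz and the weights up to n add up to 1 - 2^-(n+1); the induction needs
   this exact sum. *)
assert (H : Rabs (hinge_sum c d n t - hinge_sum c d n t')
             <= (1 - / 2 ^ S n) * (2 * Rabs (t - t'))).
{ assert (Hterm : forall s,
    Rabs (/ 2 ^ S s * hinge t (c s) (d s) - / 2 ^ S s * hinge t' (c s) (d s))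
            <= / 2 ^ S s * (2 * Rabs (t - t'))).
  { intros s. rewrite <- Rmult_minus_distr_l, Rabs_mult.
    pose proof (inv_pow2_pos (S s)). rewrite (Rabs_right (/ 2 ^ S s)) by lra.
    apply Rmult_le_compat_l; [lra|apply hinge_lipschitz]. }
  unfold hinge_sum. induction n as [|n IH].
  - simpl sum_f_R0. specialize (Hterm 0%nat). apply Rle_trans with (1 := Hterm).
    right. rewrite inv_pow2_S. simpl. field.
  - rewrite !tech5. specialize (Hterm (S n)). apply Rabs_le_between in IH, Hterm.
    apply Rabs_le. rewrite (inv_pow2_S (S n)) in *. lra. }
pose proof (inv_pow2_pos (S n)). pose proof (Rabs_pos (t - t')). nra.
Qed.

Lemma qr_hinge_sum_code p n t :
  qr (hinge_sum_code p n t) =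
  hinge_sum (fun s => qr (lower_end p s)) (fun s => qr (upper_end p s)) n (qr t).
Proof.
unfold hinge_sum_code, hinge_sum. rewrite qr_qsum. apply sum_eq. intros s _.
unfold hinge_code, hinge. now rewrite qr_qmul, qr_qpow2_inv, qr_qsub, !qr_qmax0, !qr_qsub.
Qed.

Lemma qr_qbinom n j : qr (qbinom n j) = binom n j.
Proof.
induction j as [|j IH]; [apply qr_qone|].
change (qbinom n (S j)) with
  (qmul (qbinom n j) (qmul (qsub (qfrac n 1) (qfrac j 1)) (qfrac 1 (S j)))).
rewrite !qr_qmul, qr_qsub, !qr_qfrac, IH by lia. cbn [binom]. rewrite (S_INR j).
pose proof (pos_INR j). simpl (INR 1). field. lra.
Qed.

Lemma qr_qsign m : qr (qsign m) = (-1) ^ m.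
Proof.
induction m as [|m IH]; [apply qr_qone|].
unfold qsign in *. rewrite Nat.even_succ, <- Nat.negb_even. simpl pow. rewrite <- IH.
destruct (Nat.even m); simpl; rewrite ?qr_qopp, qr_qone; ring.
Qed.

Lemma approx_poly_hinge_name p n x :
  approx_poly (hinge_name p) n x =
  bernstein (4 ^ (n + 4)) (fun k =>
    hinge_sum (fun s => qr (lower_end p s)) (fun s => qr (upper_end p s)) (S n)
      (3 * (INR k / INR (4 ^ (n + 4))) - 1)) x.
Proof.
rewrite bernstein_monomials. unfold approx_poly.
replace (hinge_name p (Cantor.to_nat (n, 0%nat))) with (4 ^ (n + 4))%nat.
2:{ unfold hinge_name. fold (pairn n 0). now rewrite fstn_pairn, sndn_pairn. }
apply sum_eq. intros j _. f_equal.
unfold hinge_name. fold (pairn n (S j)). rewrite fstn_pairn, sndn_pairn.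
cbn [Nat.ltb Nat.leb pred]. unfold coefficient_code.
rewrite qr_qmul, qr_qbinom, qr_qsum. f_equal. apply sum_eq. intros k _.
assert (H4 : (0 < 4 ^ (n + 4))%nat) by (apply Nat.neq_0_lt_0, Nat.pow_nonzero; lia).
rewrite !qr_qmul, qr_qbinom, qr_qsign, qr_hinge_sum_code, qr_qsub, qr_qfrac, qr_qone by easy.
do 3 f_equal. rewrite mult_INR. simpl (INR 3). unfold Rdiv. ring.
Qed.

(** * The limit function and its zeros for a named interval *)

Section ClosedInterval.
Context (p : Baire) (A : R -> Prop) (a b : R) (Hp : closed_name p A)
  (Hab : 0 <= a /\ a <= b /\ b <= 1) (HA : forall x, A x <-> a <= x <= b).

Let c s := qr (lower_end p s).
Let d s := qr (upper_end p s).

Lemma name_interval_disjoint n x :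
  a <= x <= b -> ~ (qr (fstn (p n)) < x < qr (sndn (p n))).
Proof.
intros Hx Hn. apply HA in Hx as HAx. destruct Hp as [_ Hc].
destruct (proj2 (Hc x)) as [_ HN]; [|now apply HN].
exists n. unfold in_rat_interval. rewrite of_nat_fstn_sndn. lra.
Qed.

Lemma complement_in_name_interval x :
  0 <= x <= 1 -> ~ (a <= x <= b) -> exists n, qr (fstn (p n)) < x < qr (sndn (p n)).
Proof.
intros Hx HN. destruct Hp as [_ Hc]. rewrite <- HA in HN.
destruct (proj1 (Hc x) (conj Hx HN)) as [n Hn]. exists n. revert Hn.
unfold in_rat_interval. rewrite of_nat_fstn_sndn. tauto.
Qed.

Lemma lower_end_S s :
  lower_end p (S s) =
  if (qltb (fstn (p (fstn s))) (lower_end p s)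
      && qltb (lower_end p s) (sndn (p (fstn s))))%bool
  then sndn (p (fstn s)) else lower_end p s.
Proof. reflexivity. Qed.

Lemma upper_end_S s :
  upper_end p (S s) =
  if (qltb (fstn (p (fstn s))) (upper_end p s)
      && qltb (upper_end p s) (sndn (p (fstn s))))%bool
  then fstn (p (fstn s)) else upper_end p s.
Proof. reflexivity. Qed.

Lemma lower_end_step s : c s <= c (S s).
Proof.
unfold c. rewrite lower_end_S.
destruct (qltb_spec (fstn (p (fstn s))) (lower_end p s)); cbn [andb]; [|lra].
destruct (qltb_spec (lower_end p s) (sndn (p (fstn s)))); lra.
Qed.

Lemma upper_end_step s : d (S s) <= d s.
Proof.
unfold d. rewrite upper_end_S.
destruct (qltb_spec (fstn (p (fstn s))) (upper_end p s)); cbn [andb]; [|lra].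
destruct (qltb_spec (upper_end p s) (sndn (p (fstn s)))); lra.
Qed.

Lemma lower_end_mono m n : (m <= n)%nat -> c m <= c n.
Proof. induction 1 as [|n _ IH]; [lra|]. pose proof (lower_end_step n). lra. Qed.

Lemma upper_end_mono m n : (m <= n)%nat -> d n <= d m.
Proof. induction 1 as [|n _ IH]; [lra|]. pose proof (upper_end_step n). lra. Qed.

Lemma lower_end_bounds s : 0 <= c s <= a.
Proof.
split.
- pose proof (lower_end_mono 0 s ltac:(lia)) as H. unfold c in *.
  change (lower_end p 0) with 0%nat in H. rewrite qr_0 in H. exact H.
- unfold c. induction s as [|s IH].
  + change (lower_end p 0) with 0%nat. rewrite qr_0. lra.
  + rewrite lower_end_S.
    destruct (qltb_spec (fstn (p (fstn s))) (lower_end p s)); cbn [andb]; [|exact IH].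
    destruct (qltb_spec (lower_end p s) (sndn (p (fstn s)))); [|exact IH].
    (* A jump beyond a would absorb an interval that starts below the current end, hence below a,
       and so contains a. *)
    apply Rnot_lt_le. intros H. apply (name_interval_disjoint (fstn s) a); lra.
Qed.

Lemma upper_end_bounds s : b <= d s <= 1.
Proof.
split.
- unfold d. induction s as [|s IH].
  + change (upper_end p 0) with qone. rewrite qr_qone. lra.
  + rewrite upper_end_S.
    destruct (qltb_spec (fstn (p (fstn s))) (upper_end p s)); cbn [andb]; [|exact IH].
    destruct (qltb_spec (upper_end p s) (sndn (p (fstn s)))); [|exact IH].
    apply Rnot_lt_le. intros H. apply (name_interval_disjoint (fstn s) b); lra.
- pose proof (upper_end_mono 0 s ltac:(lia)) as H. unfold d in *.
  change (upper_end p 0) with qone in H. rewrite qr_qone in H. exact H.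
Qed.

(* If the supremum [l] of the [c s] were below [a], some listed interval around [l]
   would be absorbed at one of the infinitely many stages at which it is inspected. *)
Lemma lower_end_limit x : x < a -> exists s, x < c s.
Proof.
intros Hx.
destruct (sequence_sup c a) as (l & Hla & Hub & Hlub); [apply lower_end_bounds|].
destruct (Rle_lt_or_eq_dec _ _ Hla) as [Hlt| ->]; [exfalso|now apply Hlub].
destruct (complement_in_name_interval l) as [n Hn]; [|lra|].
{ pose proof (lower_end_bounds 0). specialize (Hub 0%nat). lra. }
destruct (Hlub (qr (fstn (p n)))) as [s Hs]; [lra|].
(* Stage [pairn n s] inspects interval n and comes no earlier than s. *)
assert (Hs' := lower_end_mono s (pairn n s)
  ltac:(pose proof (Cantor.to_nat_non_decreasing n s); unfold pairn; lia)).
pose proof (Hub (pairn n s)) as U. pose proof (Hub (S (pairn n s))) as U'.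
unfold c in *. rewrite lower_end_S, fstn_pairn in U'.
destruct (qltb_spec (fstn (p n)) (lower_end p (pairn n s))); [cbn [andb] in U'|lra].
destruct (qltb_spec (lower_end p (pairn n s)) (sndn (p n))); lra.
Qed.

Lemma upper_end_limit x : b < x -> exists s, d s < x.
Proof.
intros Hx.
destruct (sequence_inf d b) as (l & Hlb & Hlo & Hglb); [apply upper_end_bounds|].
destruct (Rle_lt_or_eq_dec _ _ Hlb) as [Hlt|E]; [exfalso|apply Hglb; lra].
destruct (complement_in_name_interval l) as [n Hn]; [|lra|].
{ pose proof (upper_end_bounds 0). specialize (Hlo 0%nat). lra. }
destruct (Hglb (qr (sndn (p n)))) as [s Hs]; [lra|].
assert (Hs' := upper_end_mono s (pairn n s)
  ltac:(pose proof (Cantor.to_nat_non_decreasing n s); unfold pairn; lia)).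
pose proof (Hlo (pairn n s)) as U. pose proof (Hlo (S (pairn n s))) as U'.
unfold d in *. rewrite upper_end_S, fstn_pairn in U'.
destruct (qltb_spec (fstn (p n)) (upper_end p (pairn n s))); [cbn [andb] in U'|lra].
destruct (qltb_spec (upper_end p (pairn n s)) (sndn (p n))); lra.
Qed.

Lemma hinge_series_limit :
  exists f, forall x, 0 <= x <= 1 ->
    forall n, Rabs (hinge_sum c d n (3 * x - 1) - f x) <= / 2 ^ n.
Proof.
assert (H : forall x, {l | 0 <= x <= 1 ->
              forall n, Rabs (hinge_sum c d n (3 * x - 1) - l) <= / 2 ^ n}).
(* Outside [[0,1]] the value defaults to 0. Inside, the term of index n+1 is at most 2 * 2^-(n+2),
   the rate that [rapid_sequence_limit] asks for. *)
{ intros x. destruct (Rle_dec 0 x); [|now exists 0]. destruct (Rle_dec x 1); [|now exists 0].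
  destruct (rapid_sequence_limit (fun n => hinge_sum c d n (3 * x - 1))) as [l Hl];
    [|now exists l].
  intros n. unfold hinge_sum. rewrite tech5.
  match goal with |- Rabs ?e <= _ =>
    replace e with (/ 2 ^ S (S n) * hinge (3 * x - 1) (c (S n)) (d (S n))) by ring end.
  rewrite Rabs_mult. pose proof (inv_pow2_pos (S (S n))).
  rewrite Rabs_right by lra. rewrite inv_pow2_S in *.
  pose proof (lower_end_bounds (S n)). pose proof (upper_end_bounds (S n)).
  pose proof (hinge_bound (3 * x - 1) (c (S n)) (d (S n)) ltac:(lra) ltac:(lra) ltac:(lra)).
  nra. }
exists (fun x => proj1_sig (H x)). intros x. apply (proj2_sig (H x)).
Qed.

Lemma hinge_name_spec :
  exists f, cfun_name (hinge_name p) f /\ f 0 * f 1 < 0 /\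
    forall x, 0 <= x <= 1 -> f x = 0 -> a <= 3 * x - 1 <= b.
Proof.
destruct hinge_series_limit as [f Hf].
(* Here t = 3x - 1 lies below [c s], hence below every [d i]: no term is positive, and term s is
   strictly negative. *)
assert (Hneg : forall x s, 0 <= x <= 1 -> 3 * x - 1 < c s -> f x < 0).
{ intros x s Hx Hs. apply (negative_series_limit _ _ s (Hf x Hx)).
  - intros i. pose proof (inv_pow2_pos (S i)). pose proof (lower_end_bounds s).
    pose proof (upper_end_bounds i). unfold hinge.
    rewrite (Rmax_left 0 (3 * x - 1 - d i)) by lra.
    pose proof (Rmax_l 0 (c i - (3 * x - 1))). nra.
  - pose proof (inv_pow2_pos (S s)). pose proof (lower_end_bounds s).
    pose proof (upper_end_bounds s). unfold hinge.
    rewrite (Rmax_left 0 (3 * x - 1 - d s)), Rmax_right by lra. nra. }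
assert (Hpos : forall x s, 0 <= x <= 1 -> d s < 3 * x - 1 -> 0 < f x).
{ intros x s Hx Hs. apply (positive_series_limit _ _ s (Hf x Hx)).
  - intros i. pose proof (inv_pow2_pos (S i)). pose proof (upper_end_bounds s).
    pose proof (lower_end_bounds i). unfold hinge.
    rewrite (Rmax_left 0 (c i - (3 * x - 1))) by lra.
    pose proof (Rmax_l 0 (3 * x - 1 - d i)). nra.
  - pose proof (inv_pow2_pos (S s)). pose proof (lower_end_bounds s).
    pose proof (upper_end_bounds s). unfold hinge.
    rewrite (Rmax_left 0 (c s - (3 * x - 1))), Rmax_right by lra. nra. }
exists f. split; [|split].
- intros n x Hx. rewrite approx_poly_hinge_name. fold c d.
  (* The Lipschitz constant 6 is 2 from the hinge sum times 3 from the substitution. *)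
  pose proof (bernstein_approx (n + 4) 6 (fun y => hinge_sum c d (S n) (3 * y - 1)) x) as HB.
  cbv beta in HB. apply Rabs_le_between in HB; [|lra|exact Hx|].
  + specialize (Hf x Hx (S n)). apply Rabs_le_between in Hf. rewrite inv_pow2_S in Hf.
    assert (E : / 2 ^ (n + 4) = / 2 ^ n / 16).
    { replace (n + 4)%nat with (S (S (S (S n)))) by lia. rewrite !inv_pow2_S. lra. }
    rewrite E in HB.
    pose proof (inv_pow2_pos n). apply Rabs_le. lra.
  + intros y. apply Rle_trans with (1 := hinge_sum_lipschitz _ _ _ _ _).
    replace (3 * y - 1 - (3 * x - 1)) with (3 * (y - x)) by ring.
    rewrite Rabs_mult, (Rabs_right 3) by lra. lra.
(* At x = 0 and x = 1 the substituted values -1 and 2 lie strictly outside [[0,1]], where all ends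
   lie. *)
- pose proof (lower_end_bounds 0). pose proof (upper_end_bounds 0).
  pose proof (Hneg 0 0%nat ltac:(lra) ltac:(lra)).
  pose proof (Hpos 1 0%nat ltac:(lra) ltac:(lra)). nra.
- intros x Hx E. split; apply Rnot_lt_le; intros H.
  + destruct (lower_end_limit _ H) as [s Hs]. pose proof (Hneg x s Hx Hs). lra.
  + destruct (upper_end_limit _ H) as [s Hs]. pose proof (Hpos x s Hx Hs). lra.
Qed.
End ClosedInterval.

Lemma triple_minus_one_spec r x :
  real_name r x -> real_name (triple_minus_one r) (3 * x - 1).
Proof.
intros Hr n. unfold triple_minus_one. rewrite qr_qsub, qr_qmul, qr_qone, qr_qfrac by lia.
specialize (Hr (n + 2)%nat). replace (n + 2)%nat with (S (S n)) in * by lia.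
rewrite !inv_pow2_S in Hr. pose proof (inv_pow2_pos n).
apply Rabs_le_between in Hr. apply Rabs_le. simpl (INR _). lra.
Qed.

Lemma C_I_le_IVT : sW_le C_I IVT.
Proof.
apply sW_le_intro with (H := triple_minus_one) (K := hinge_name).
- apply computable_triple_minus_one.
- apply computable_hinge_name.
- intros p A Hp (a & b & Ha & Hab & Hb & HA).
  destruct (hinge_name_spec p A a b Hp ltac:(lra) HA) as (f & Hf & Hsign & Hzero).
  exists f. split; [exact Hf|split; [exact Hsign|]].
  intros r x [_ Hr] [Hx Hfx]. specialize (Hzero x Hx Hfx).
  exists (3 * x - 1). split; [split|].
  + simpl. lra.
  + now apply triple_minus_one_spec.
  + now apply HA.
Qed.

Theorem theorem6p2 : sW_equiv IVT C_I.
Proof. split; [exact IVT_le_C_I | exact C_I_le_IVT]. Qed.
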